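(* Let $m$ and $n$ be positive integers and let $G=\mathrm{Tor}(m,n)=\langle a,b\mid a^m=b^n\rangle$. Then: (1) the center of $G$ is infinite cyclic, generated by the element $a^m=b^n$; (2) $G$ is virtually a direct product of a free group and an infinite cyclic group; (3) every nontrivial reduced word equivalent to the identity in $G$ contains a subword equal to $a^m$ or $b^n$ or their inverses; (4) every word equivalent to the identity in $G$ can be reduced to the identity by iteratively replacing $a^m$ with $b^n$, replacing $b^n$ with $a^m$, and performing free reductions.
   Context: The group $\mathrm{Tor}(m,n)$ defined by the presentation $\langle a,b\mid a^m=b^n\rangle$ is called a torus knot group (here $m,n$ are not required to be relatively prime). Words are over the alphabet $\{a,b,a^{-1},b^{-1}\}$; a word is equivalent to the identity in $G$ if it represents the identity element of $G$. A subword is a block of consecutive letters. A word is reduced if it contains no subword $xx^{-1}$ or $x^{-1}x$ with $x\in\{a,b\}$; a free reduction deletes such a subword; a nontrivial word is a nonempty one, and reducing a word to the identity means reducing it to the empty word. A group is virtually a direct product of a free group and an infinite cyclic group if it has a finite-index subgroup isomorphic to $F\times\mathbb{Z}$ for some free group $F$.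
   Formalization: In (1), that a^m generates the center is claimed only when m, n are both 1 or both greater than 1 (it fails if exactly one is 1); in (4), replacing a^{-m} with b^{-n} and conversely is also allowed, since positive replacements alone do not suffice. *)

(* Defs.v *)
From HB Require Import structures.
From Stdlib Require Import Relation_Operators.
From mathcomp Require Import all_boot ssralg ssrint boolp.

Set Implicit Arguments.
Unset Strict Implicit.
Unset Printing Implicit Defensive.

Local Open Scope group_scope.
Local Open Scope quotient_scope.

Section Words.
Variable X : choiceType.

(* The letter (x, false) stands for x and (x, true) for x^-1. *)
Definition word : Type := seq (X * bool).

Definition letter_inv (l : X * bool) : X * bool := (l.1, ~~ l.2).

Definition word_inv (w : word) : word := rev [seq letter_inv l | l <- w].

(* [syllable x s k] is the word x^k if s = false and x^-k if s = true. *)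
Definition syllable (x : X) (s : bool) (k : nat) : word := nseq k (x, s).

Definition reduced (w : word) : Prop :=
  forall l : X * bool, ~~ infix [:: l; letter_inv l] w.

Inductive free_reduction : word -> word -> Prop :=
| FreeReduction (u v : word) (l : X * bool) :
    free_reduction (u ++ [:: l; letter_inv l] ++ v) (u ++ v).

(* The least congruence on words containing the free reductions and the
   relations [l = r] for which [R l r] holds. *)
Inductive pres_eq (R : word -> word -> Prop) : word -> word -> Prop :=
| PresFree u v : free_reduction u v -> pres_eq R u v
| PresRel u v l r : R l r -> pres_eq R (u ++ l ++ v) (u ++ r ++ v)
| PresRefl u : pres_eq R u u
| PresSym u v : pres_eq R u v -> pres_eq R v u
| PresTrans u v w : pres_eq R u v -> pres_eq R v w -> pres_eq R u w.

End Words.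

Section PresentedGroup.
Variables (X : choiceType) (R : word X -> word X -> Prop).
Implicit Types u v w : word X.

Definition pres_rel : rel (word X) := fun u v => `[< pres_eq R u v >].

Lemma pres_rel_refl : reflexive pres_rel.
Proof. by move=> u; apply/asboolP; apply: PresRefl. Qed.

Lemma pres_rel_sym : symmetric pres_rel.
Proof.
by move=> u v; apply/asboolP/asboolP => h; apply: PresSym.
Qed.

Lemma pres_rel_trans : transitive pres_rel.
Proof.
move=> v u w /asboolP huv /asboolP hvw; apply/asboolP.
exact: PresTrans huv hvw.
Qed.

Canonical pres_equiv_rel :=
  EquivRel pres_rel pres_rel_refl pres_rel_sym pres_rel_trans.

(* The group with presentation < X | l = r for all l, r such that R l r >. *)
Definition pres_group : Type := {eq_quot pres_rel}.

HB.instance Definition _ := Choice.on pres_group.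
HB.instance Definition _ := EqQuotient.on pres_group.

Definition word_val (w : word X) : pres_group := \pi_pres_group w.

Lemma word_valP u v : word_val u = word_val v <-> pres_eq R u v.
Proof.
rewrite /word_val; split => [/eqP|h]; last by apply/eqP; rewrite piE; apply/asboolP.
by rewrite piE => /asboolP.
Qed.

Lemma pres_eq_ctx s t u v :
  pres_eq R u v -> pres_eq R (s ++ u ++ t) (s ++ v ++ t).
Proof.
elim=> {u v} [_ _ [u v l]|u v l r lr|u|u v _ h|u v w _ h1 _ h2].
- have -> : s ++ (u ++ [:: l; letter_inv l] ++ v) ++ t
          = (s ++ u) ++ [:: l; letter_inv l] ++ (v ++ t) by rewrite -!catA.
  have -> : s ++ (u ++ v) ++ t = (s ++ u) ++ (v ++ t) by rewrite -!catA.
  exact/PresFree/FreeReduction.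
- have E z : s ++ (u ++ z ++ v) ++ t = (s ++ u) ++ z ++ (v ++ t).
    by rewrite -!catA.
  by rewrite !E; apply: PresRel.
- exact: PresRefl.
- exact: PresSym.
- exact: PresTrans h1 h2.
Qed.

Lemma pres_eq_cat u u' v v' :
  pres_eq R u u' -> pres_eq R v v' -> pres_eq R (u ++ v) (u' ++ v').
Proof.
move=> hu hv; apply: (@PresTrans _ _ _ (u' ++ v)).
  exact: (pres_eq_ctx [::] v hu).
by have := pres_eq_ctx u' [::] hv; rewrite !cats0.
Qed.

Lemma letter_invK : involutive (@letter_inv X).
Proof. by case=> x b; rewrite /letter_inv /= negbK. Qed.

Lemma word_invK : involutive (@word_inv X).
Proof.
move=> w; rewrite /word_inv map_rev revK -map_comp -[RHS]map_id.
exact/eq_map/letter_invK.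
Qed.

Lemma pres_eqVw w : pres_eq R (word_inv w ++ w) [::].
Proof.
elim: w => [|l w IHw]; first exact: PresRefl.
rewrite /word_inv /= rev_cons cat_rcons.
apply: PresTrans IHw; apply/PresFree.
by have := FreeReduction (word_inv w) w (letter_inv l); rewrite letter_invK.
Qed.

Lemma pres_eqwV w : pres_eq R (w ++ word_inv w) [::].
Proof. by have := pres_eqVw (word_inv w); rewrite word_invK. Qed.

Lemma pres_eq_inv u v : pres_eq R u v -> pres_eq R (word_inv u) (word_inv v).
Proof.
move=> huv; apply: (@PresTrans _ _ _ (word_inv u ++ v ++ word_inv v)).
  apply: PresSym.
  by have := pres_eq_cat (PresRefl R (word_inv u)) (pres_eqwV v); rewrite cats0.
have := pres_eq_ctx (word_inv u) (word_inv v) (PresSym huv).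
move/PresTrans; apply; rewrite catA.
exact: (pres_eq_cat (pres_eqVw u) (PresRefl R _)).
Qed.

Definition pres_mul (x y : pres_group) : pres_group :=
  word_val (repr x ++ repr y).
Definition pres_one : pres_group := word_val [::].
Definition pres_inv (x : pres_group) : pres_group :=
  word_val (word_inv (repr x)).

Lemma repr_word_val w : pres_eq R (repr (word_val w)) w.
Proof. by apply/word_valP; rewrite /word_val reprK. Qed.

Lemma word_val_repr (x : pres_group) : word_val (repr x) = x.
Proof. exact: reprK. Qed.

Lemma pres_mulE u v : pres_mul (word_val u) (word_val v) = word_val (u ++ v).
Proof. by apply/word_valP/pres_eq_cat; apply: repr_word_val. Qed.

Lemma pres_invE w : pres_inv (word_val w) = word_val (word_inv w).
Proof. by apply/word_valP/pres_eq_inv; apply: repr_word_val. Qed.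

Lemma pres_mulA : associative pres_mul.
Proof.
move=> x y z; rewrite -(word_val_repr x) -(word_val_repr y) -(word_val_repr z).
by rewrite !pres_mulE catA.
Qed.

Lemma pres_mul1 : left_id pres_one pres_mul.
Proof. by move=> x; rewrite -(word_val_repr x) pres_mulE. Qed.

Lemma pres_mulr1 : right_id pres_one pres_mul.
Proof. by move=> x; rewrite -(word_val_repr x) pres_mulE cats0. Qed.

Lemma pres_mulV : left_inverse pres_one pres_inv pres_mul.
Proof.
move=> x; rewrite -(word_val_repr x) pres_invE pres_mulE.
exact/word_valP/pres_eqVw.
Qed.

Lemma pres_mulrV : right_inverse pres_one pres_inv pres_mul.
Proof.
move=> x; rewrite -(word_val_repr x) pres_invE pres_mulE.
exact/word_valP/pres_eqwV.
Qed.

HB.instance Definition _ := isGroup.Build pres_group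
  pres_mulA pres_mul1 pres_mulr1 pres_mulV pres_mulrV.

Lemma word_val_nil : word_val [::] = 1.
Proof. exact: (erefl pres_one). Qed.

Lemma word_val_cat u v : word_val (u ++ v) = word_val u * word_val v.
Proof. exact/esym/pres_mulE. Qed.

Lemma word_val_inv w : word_val (word_inv w) = (word_val w)^-1.
Proof. exact/esym/pres_invE. Qed.

End PresentedGroup.

Arguments word_val {X} R w.

Definition free_group (X : choiceType) : Type :=
  pres_group (fun _ _ : word X => False).
HB.instance Definition _ (X : choiceType) := Group.on (free_group X).

Section GroupNotions.
Variable G : groupType.

Definition expgz (x : G) (k : int) : G :=
  match k with Posz i => x ^+ i | Negz i => x ^- i.+1 end.

Definition cyclic_subgroup (x : G) : {pred G} :=
  [pred y | `[< exists k : int, y = expgz x k >]].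

Definition center : {pred G} := [pred z | `[< forall x : G, commute z x >]].

Definition finite_index (H : {pred G}) : Prop :=
  exists s : seq G, forall x : G, exists2 t, t \in s & t^-1 * x \in H.

Definition isomorphic_to (K : groupType) (H : {pred G}) : Prop :=
  exists f : {multiplicative K -> G},
    injective f /\ (forall x : G, x \in H <-> exists k : K, f k = x).

Definition infinite_cyclic (H : {pred G}) : Prop :=
  isomorphic_to (Algebra.to_multiplicative int) H.

Definition virtually_free_times_Z : Prop :=
  exists (H : {pred G}) (X : choiceType),
    [/\ group_closed H, finite_index H &
        isomorphic_to (free_group X * Algebra.to_multiplicative int)%type H].

End GroupNotions.

Arguments center G : clear implicits.

(* The generators are a := false and b := true. *)
Definition tor_a : bool := false.
Definition tor_b : bool := true.

Inductive tor_relator (m n : nat) : word bool -> word bool -> Prop :=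
| TorRelator :
    tor_relator m n (syllable tor_a false m) (syllable tor_b false n).

Definition Tor (m n : nat) : Type := pres_group (tor_relator m n).
HB.instance Definition _ (m n : nat) := Group.on (Tor m n).

Definition Tor_val (m n : nat) (w : word bool) : Tor m n :=
  word_val (tor_relator m n) w.

Definition Tor_a (m n : nat) : Tor m n := Tor_val m n [:: (tor_a, false)].
Definition Tor_b (m n : nat) : Tor m n := Tor_val m n [:: (tor_b, false)].

(* The sign s lets a^m <-> b^n be applied to a^-m and b^-n as well. With the
   positive replacements alone not every word equal to 1 would reduce to the
   empty word: for m = 3 and n = 2, none of them, and no free reduction,
   applies to a b a^-3 b^-1 a^2. *)
Inductive tor_step (m n : nat) : word bool -> word bool -> Prop :=
| TorStepFree u v : free_reduction u v -> tor_step m n u v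
| TorStepAB u v s : tor_step m n (u ++ syllable tor_a s m ++ v)
                                 (u ++ syllable tor_b s n ++ v)
| TorStepBA u v s : tor_step m n (u ++ syllable tor_b s n ++ v)
                                 (u ++ syllable tor_a s m ++ v).

Definition tor_reduces (m n : nat) : word bool -> word bool -> Prop :=
  clos_refl_trans (word bool) (tor_step m n).

(* Main.v *)
(* The element z = a^m = b^n is central, and the exponent sum a |-> n,
   b |-> m shows that it has infinite order.

   Modulo z, the group acts on the normal forms of Z/m * Z/n. A product of
   alternating syllables x^k with 0 < |k| < ord x sends the empty normal form
   to one with as many syllables, hence is not a power of z unless it is
   empty. This gives (3) at once. It gives (4) because every word reduces to such
   a product preceded by one arbitrary power of a generator. It gives (1)
   because a nonempty such product fails to commute with the generator that
   differs from its last one.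

   For (2), let F be free on symbols c_(i,j) with 0 < i < m and 0 < j < n.
   The group acts on Z/m x Z/n x F so that [a^i, b^j] acts on
   (0, 0, p) as left multiplication by c_(i,j); hence the commutators
   [a^i, b^j] freely generate a subgroup which, together with z, generates
   a copy of F x Z, and the cosets of a^i b^j cover the group. *)
From HB Require Import structures.
From Stdlib Require Import Relation_Operators.
Require Import Defs.
From mathcomp Require Import all_boot ssralg ssrint zmodp boolp.

Local Open Scope group_scope.

(** * Groups given by presentations *)

Section PresentationActions.
Variables (X : choiceType) (R : word X -> word X -> Prop) (Y : Type).
Variable act : X * bool -> Y -> Y.
Hypothesis actK : forall l y, act l (act (letter_inv l) y) = y.
Hypothesis actR : forall l r y, R l r -> foldr act y l = foldr act y r.

(** Free reductions act trivially because inverse letters act by inverse maps, and relations are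
    respected by [actR]; so the action of words descends to the group. *)
Lemma pres_eq_foldr u v : pres_eq R u v ->
  forall y, foldr act y u = foldr act y v.
Proof.
elim=> {u v} [_ _ [u v l] y|u v l r lr y|//|u v _ IH y|u v w _ IH1 _ IH2 y].
- by rewrite !foldr_cat /= actK.
- by rewrite !foldr_cat (actR _ _ _ lr).
- by rewrite IH.
- by rewrite IH1 IH2.
Qed.

Definition pres_act (g : pres_group R) (y : Y) : Y := foldr act y (repr g).

Lemma pres_actE w y : pres_act (word_val R w) y = foldr act y w.
Proof. exact/pres_eq_foldr/repr_word_val. Qed.

Lemma pres_act1 y : pres_act 1 y = y.
Proof. by rewrite -word_val_nil pres_actE. Qed.

Lemma pres_actM g h y : pres_act (g * h) y = pres_act g (pres_act h y).
Proof.
rewrite -(word_val_repr g) -(word_val_repr h) -word_val_cat.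
by rewrite !pres_actE foldr_cat.
Qed.

Lemma pres_actVK g : cancel (pres_act g) (pres_act g^-1).
Proof. by move=> y; rewrite -pres_actM mulVg pres_act1. Qed.

Lemma pres_actX g k y : pres_act (g ^+ k) y = iter k (pres_act g) y.
Proof. by elim: k => [|k IHk]; rewrite ?pres_act1 // expgS pres_actM IHk. Qed.

End PresentationActions.

Section PresentationLift.
Variables (X : choiceType) (R : word X -> word X -> Prop) (G : groupType).
Variable phi : X -> G.

Definition letter_lift (l : X * bool) : G :=
  if l.2 then (phi l.1)^-1 else phi l.1.

Definition word_lift (w : word X) : G :=
  foldr (fun l => mul (letter_lift l)) 1 w.

Lemma word_lift_cat u v : word_lift (u ++ v) = word_lift u * word_lift v.
Proof.
by elim: u => [|l u IHu]; rewrite ?mul1g //= -/(word_lift _) IHu mulgA.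
Qed.

Lemma word_lift_syllable x k : word_lift (syllable x false k) = phi x ^+ k.
Proof. by elim: k => // k IHk; rewrite /= -/(word_lift _) IHk expgS. Qed.

Definition pres_lift (g : pres_group R) : G := word_lift (repr g).

Hypothesis phiR : forall l r, R l r -> word_lift l = word_lift r.

(** The universal property of the presentation: let the letters act on [G] by left
    multiplication. *)
Lemma pres_liftE w : pres_lift (word_val R w) = word_lift w.
Proof.
have foldrE u y : foldr (fun l => mul (letter_lift l)) y u = word_lift u * y.
  by elim: u => [|l u IHu]; rewrite ?mul1g //= IHu mulgA.
apply: (pres_eq_foldr X R G (fun l => mul (letter_lift l)) _ _ _ _
  (repr_word_val R w)) => [[x []] y|l r y lr].
- by rewrite /letter_lift /= mulKg.
- by rewrite /letter_lift /= mulVKg.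
- by rewrite !foldrE (phiR _ _ lr).
Qed.

Lemma pres_liftM : {morph pres_lift : g h / g * h}.
Proof.
move=> g h; rewrite -(word_val_repr g) -(word_val_repr h) -word_val_cat.
by rewrite !pres_liftE word_lift_cat.
Qed.

End PresentationLift.

(** * Integer powers and infinite cyclic subgroups *)

Section IntegerPowers.
Variable G : groupType.
Implicit Types x y : G.

Lemma expgzB x (i j : nat) : expgz x (Posz i - Posz j)%R = x ^+ i / x ^+ j.
Proof.
case: (leqP j i) => [le_ji|lt_ij]; first by rewrite subzn // -expgnFr.
rewrite -GRing.opprB subzn 1?ltnW //.
have: x ^+ (j - i) = x ^+ j / x ^+ i by rewrite expgnFr 1?ltnW.
case: (j - i)%N (subn_gt0 i j) => [|d _]; first by rewrite lt_ij.
by rewrite -NegzE /= => ->; rewrite invgF.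
Qed.

Lemma int_subP (k : int) : exists i j : nat, k = (Posz i - Posz j)%R.
Proof.
by case: k => i; [exists i, 0%N; rewrite GRing.subr0
                 | exists 0%N, i.+1; rewrite NegzE GRing.sub0r].
Qed.

Lemma expgzD x (k l : int) : expgz x (k + l)%R = expgz x k * expgz x l.
Proof.
have [[i [j ->]] [i' [j' ->]]] := (int_subP k, int_subP l).
have -> : (Posz i - Posz j + (Posz i' - Posz j') =
           Posz (i + i') - Posz (j' + j))%R.
  by rewrite !PoszD GRing.opprD GRing.addrACA [(- _ - _)%R]GRing.addrC.
rewrite !expgzB !expgnDr invgM -!mulgA; congr (_ * _).
rewrite !mulgA; congr (_ * _).
exact/commuteV/commuteX2/commute_refl.
Qed.

Lemma commute_expgz x y k : commute x y -> commute x (expgz y k).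
Proof. by case: k => i xy; rewrite /expgz; do ?apply: commuteV; apply: commuteX. Qed.

Lemma expgz_eq1 x k :
  (forall i, x ^+ i = 1 -> i = 0%N) -> expgz x k = 1 -> k = 0%R.
Proof.
move=> xP; case: k => i /=; first by move/xP->.
by move/eqP; rewrite invg_eq1 => /eqP /xP.
Qed.

Lemma cyclic_infinite x (H : {pred G}) :
  (forall i, x ^+ i = 1 -> i = 0%N) -> H =i cyclic_subgroup x ->
  infinite_cyclic H.
Proof.
move=> xP HE.
pose f : {multiplicative Algebra.to_multiplicative int -> G} :=
  HB.pack (expgz x : Algebra.to_multiplicative int -> G)
          (isMultiplicative.Build (Algebra.to_multiplicative int) G (expgz x) (expgzD x)).
exists f; split=> [k l /= fkl|y].
  have: expgz x (k - l)%R = 1.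
    apply: (mulIg (expgz x l)); rewrite -expgzD GRing.subrK mul1g; exact: fkl.
  by move/(expgz_eq1 _ _ xP)/eqP; rewrite GRing.subr_eq0 => /eqP.
rewrite HE inE /=; split=> [/asboolP [k ->]|[k <-]]; first by exists k.
by apply/asboolP; exists k.
Qed.

End IntegerPowers.

(** * The central element a^m = b^n *)

Section TorusKnotGroup.
Variables m n : nat.
Hypotheses (m_gt0 : (0 < m)%N) (n_gt0 : (0 < n)%N).

Local Notation G := (Tor m n).

Definition Tor_gen (x : bool) : G := Tor_val m n [:: (x, false)].
Definition Tor_ord (x : bool) : nat := if x then n else m.
Definition Tor_z : G := Tor_a m n ^+ m.

Lemma Tor_ord_gt0 x : (0 < Tor_ord x)%N.
Proof. by case: x. Qed.

Lemma Tor_val_cons x s w :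
  Tor_val m n ((x, s) :: w) =
  (if s then (Tor_gen x)^-1 else Tor_gen x) * Tor_val m n w.
Proof.
by rewrite -cat1s /Tor_val word_val_cat; case: s; rewrite // -word_val_inv.
Qed.

Lemma Tor_val_syllable x s k :
  Tor_val m n (syllable x s k) = if s then Tor_gen x ^- k else Tor_gen x ^+ k.
Proof.
elim: k => [|k IHk]; first by case: s; rewrite ?invg1 /Tor_val word_val_nil.
rewrite [syllable _ _ _]/= Tor_val_cons IHk.
by case: s {IHk}; rewrite ?expgS // -invgM -expgSr expgS.
Qed.

Lemma Tor_gen_ord x : Tor_gen x ^+ Tor_ord x = Tor_z.
Proof.
have relE : Tor_val m n (syllable tor_a false m) =
            Tor_val m n (syllable tor_b false n).
  apply/word_valP; have := PresRel (R := tor_relator m n) [::] [::] (TorRelator m n).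
  by rewrite /= !cats0.
by move: relE; rewrite !Tor_val_syllable; case: x => // ->.
Qed.

Lemma Tor_ind (P : G -> Prop) : P 1 ->
  (forall x g, P g -> P (Tor_gen x * g) /\ P ((Tor_gen x)^-1 * g)) ->
  forall g, P g.
Proof.
move=> P1 PM g; rewrite -(word_val_repr g); elim: (repr g) => [|[x s] w IHw].
  by rewrite word_val_nil.
by have := Tor_val_cons x s w; rewrite /Tor_val => ->; case: (PM x _ IHw); case: s.
Qed.

Lemma Tor_z_central g : commute Tor_z g.
Proof.
elim/Tor_ind: g => [|x g zg]; first exact: commute1.
have zx : commute Tor_z (Tor_gen x).
  by rewrite -(Tor_gen_ord x); apply/commute_sym/commuteX/commute_refl.
by split; apply: commuteM => //; apply: commuteV.
Qed.

Lemma Tor_gen_infinite x k : Tor_gen x ^+ k = 1 -> k = 0%N.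
Proof.
(* Each generator is sent to the exponent of the other, so both sides of the relation go to the
   integer mn. *)
pose phi y : Algebra.to_multiplicative int := Posz (Tor_ord (~~ y)).
have expE (i j : nat) :
    (Posz i : Algebra.to_multiplicative int) ^+ j = Posz (i * j).
  elim: j => [|j IHj]; first by rewrite muln0.
  by rewrite expgS IHj mulnS PoszD.
have phiR l r : tor_relator m n l r -> word_lift _ _ phi l = word_lift _ _ phi r.
  by case; rewrite !word_lift_syllable !expE /= mulnC.
move=> xk; have: pres_lift _ _ _ phi (Tor_val m n (syllable x false k)) = 1.
  by rewrite Tor_val_syllable xk -word_val_nil pres_liftE.
rewrite pres_liftE // word_lift_syllable expE => -[] /eqP.
by rewrite muln_eq0 eqn0Ngt Tor_ord_gt0 => /eqP.
Qed.

Lemma Tor_z_infinite k : Tor_z ^+ k = 1 -> k = 0%N.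
Proof.
rewrite -(Tor_gen_ord false) -expgnA => /Tor_gen_infinite /eqP.
by rewrite muln_eq0 eqn0Ngt Tor_ord_gt0 => /eqP.
Qed.

Lemma Tor_zX_central k g : commute (Tor_z ^+ k) g.
Proof. exact/commute_sym/commuteX/commute_sym/Tor_z_central. Qed.

Lemma Tor_gen_mod x k : Tor_gen x ^+ k =
  Tor_gen x ^+ (k %% Tor_ord x) * Tor_z ^+ (k %/ Tor_ord x).
Proof. by rewrite -(Tor_gen_ord x) -expgnA -expgnDr mulnC addnC -divn_eq. Qed.

End TorusKnotGroup.

(** * The subgroup generated by a^m and the commutators [a^i, b^j] *)

(** Since a^m = b^n is central, this lets the exponents in [a^i, b^j] be reduced modulo m and n. *)
Lemma commg_centralMl (G : groupType) (x y c : G) :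
  (forall g, commute c g) -> [~ x * c, y] = [~ x, y].
Proof.
move=> cC; rewrite !commgEl conjMg invgM -mulgA.
have -> : c ^ y = c by rewrite conjgE (cC y) mulKg.
by rewrite -(cC (x ^ y)) [x^-1 * (c * _)]mulgA -(cC x^-1) -mulgA mulKg.
Qed.

Section FreeTimesCyclicSubgroup.
Variables m' n' : nat.
Local Notation m := m'.+1.
Local Notation n := n'.+1.
Local Notation G := (Tor m n).
Local Notation a := (Tor_gen m n false).
Local Notation b := (Tor_gen m n true).
Local Notation z := (Tor_z m n).

Definition comm_index : choiceType :=
  {ij : 'I_m * 'I_n | (ij.1 != ord0) && (ij.2 != ord0)}.
Local Notation F := (free_group comm_index).

Definition free_gen (ij : comm_index) : F := word_val _ [:: (ij, false)].

(** The value 1 for i = 0 or j = 0 matches [a^i, b^j] = 1 in these cases. *)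
Definition free_comm (i : 'I_m) (j : 'I_n) : F :=
  if insub (i, j) is Some ij then free_gen ij else 1.

Lemma free_comm0l j : free_comm ord0 j = 1.
Proof. by rewrite /free_comm insubF. Qed.

Lemma free_comm0r i : free_comm i ord0 = 1.
Proof. by rewrite /free_comm insubF //= andbF. Qed.

(* Left multiplication of [G] on its quotient by the powers of [z], read
   through the bijection sending [(i, j, p)] to the class of [a^i b^j p]: with
   [c_(i,j) = [a^i, b^j]], one has
   [b a^i b^j = a^i b^(j+1) c_(i,j+1)^-1 c_(i,j)]. *)
Definition coset_act (l : bool * bool) (y : 'I_m * 'I_n * F) :=
  let: (i, j, p) := y in
  if l.1 then
    let j' := (if l.2 then j - inZp 1 else j + inZp 1)%R in
    (i, j', (free_comm i j')^-1 * (free_comm i j * p))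
  else ((if l.2 then i - inZp 1 else i + inZp 1)%R, j, p).

Lemma coset_actK l y : coset_act l (coset_act (letter_inv l) y) = y.
Proof.
case: l y => [[] []] [[i j] p] /=;
  by rewrite ?GRing.addrK ?GRing.subrK ?mulVKg ?mulKg.
Qed.

Lemma inZpS k l : (inZp l + inZp 1 = inZp l.+1 :> 'I_k.+1)%R.
Proof. by apply: val_inj; rewrite /= modnDml modnDmr addn1. Qed.

Lemma coset_act_syllable_a i j p k :
  foldr coset_act (inZp i, j, p) (syllable tor_a false k) =
  (inZp (i + k), j, p).
Proof. by elim: k => [|k IHk]; rewrite ?addn0 //= IHk /= inZpS addnS. Qed.

(** The factors telescope: each step cancels the [free_comm] introduced by the previous one. *)
Lemma coset_act_syllable_b i j p k :
  foldr coset_act (i, inZp j, p) (syllable tor_b false k) =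
  (i, inZp (j + k), (free_comm i (inZp (j + k)))^-1 *
                    (free_comm i (inZp j) * p)).
Proof.
elim: k => [|k IHk]; first by rewrite addn0 mulKg.
by rewrite /= IHk /= inZpS addnS mulVKg.
Qed.

(** Both sides act as the identity: m steps bring i back, n steps bring j back, and then the two
    factors left by the telescoping cancel. *)
Lemma coset_actR l r y : tor_relator m n l r ->
  foldr coset_act y l = foldr coset_act y r.
Proof.
case: y => [[i j] p] [].
have inZpDord k (x : 'I_k.+1) : inZp (x + k.+1) = x.
  by apply: val_inj; rewrite /= modnDr modn_small.
rewrite -[i]valZpK -[j]valZpK coset_act_syllable_a coset_act_syllable_b.
by rewrite !inZpDord !valZpK mulKg.
Qed.

Local Notation gact := (pres_act bool (tor_relator m n) _ coset_act).
Let gactE := pres_actE _ _ _ _ coset_actK coset_actR.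
Let gact1 := pres_act1 _ _ _ _ coset_actK coset_actR.
Let gactM := pres_actM _ _ _ _ coset_actK coset_actR.
Let gactX := pres_actX _ _ _ _ coset_actK coset_actR.
Let gactK := pres_actVK _ _ _ _ coset_actK coset_actR.

Lemma gact_a j p k : gact (a ^+ k) (ord0, j, p) = (inZp k, j, p).
Proof.
rewrite -(Tor_val_syllable _ _ _ false) gactE.
have -> : ord0 = inZp 0 :> 'I_m by apply: val_inj; rewrite /= mod0n.
by rewrite coset_act_syllable_a.
Qed.

Lemma gact_b i p k : gact (b ^+ k) (i, ord0, p) =
  (i, inZp k, (free_comm i (inZp k))^-1 * p).
Proof.
rewrite -(Tor_val_syllable _ _ _ false) gactE.
have E : ord0 = inZp 0 :> 'I_n by apply: val_inj; rewrite /= mod0n.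
by rewrite {1}E coset_act_syllable_b -E free_comm0r mul1g.
Qed.

Lemma gact_comm i j p :
  gact [~ a ^+ i, b ^+ j] (ord0, ord0, p) =
  (ord0, ord0, free_comm (inZp i) (inZp j) * p).
Proof.
(* Apply b^j a^i to both sides and use b^j a^i [a^i, b^j] = a^i b^j. *)
apply: (can_inj (gactK (b ^+ j * a ^+ i))).
rewrite -[LHS]gactM -commgC !gactM !gact_a gact_b free_comm0l invg1 mul1g.
by rewrite gact_a gact_b mulKg.
Qed.

Lemma gact_z y : gact z y = y.
Proof.
case: y => [[i j] p]; rewrite /z /Tor_a -[Tor_val _ _ _]/a.
rewrite -(Tor_val_syllable _ _ _ false) gactE -[i]valZpK coset_act_syllable_a.
by congr (_, _, _); apply: val_inj; rewrite /= modnDr.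
Qed.

Definition free_to_Tor : F -> G :=
  pres_lift _ _ _ (fun ij : comm_index => [~ a ^+ (val ij).1, b ^+ (val ij).2]).

Lemma free_to_TorM : {morph free_to_Tor : p q / p * q}.
Proof. exact: pres_liftM. Qed.

(** The action reads p back from its image, so the commutators generate freely. *)
Lemma gact_free p : gact (free_to_Tor p) (ord0, ord0, 1) = (ord0, ord0, p).
Proof.
rewrite -(word_val_repr p) /free_to_Tor pres_liftE //.
elim: (repr p) => [|[ij s] w IHw]; first by rewrite [LHS]gact1 word_val_nil.
rewrite [word_lift _ _ _ _]/= -/(word_lift _ _ _ _) gactM IHw /letter_lift /=.
have commE q : gact [~ a ^+ (val ij).1, b ^+ (val ij).2] (ord0, ord0, q) =
               (ord0, ord0, free_gen ij * q).
  by rewrite gact_comm !valZpK /free_comm -surjective_pairing valK.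
rewrite -cat1s word_val_cat; case: s; last exact: commE.
have -> : word_val _ [:: (ij, true)] = (free_gen ij)^-1 by rewrite -word_val_inv.
(* For an inverse letter, write w as c (c^-1 w), read the left factor c as the action of the
   commutator, and cancel it. *)
by rewrite -{1}[word_val _ w](mulVKg (free_gen ij)) -commE gactK.
Qed.

Lemma free_comm_Tor i j :
  free_to_Tor (free_comm (inZp i) (inZp j)) = [~ a ^+ i, b ^+ j].
Proof.
rewrite (Tor_gen_mod _ _ false i) (Tor_gen_mod _ _ true j).
rewrite commg_centralMl => [|g]; last exact: Tor_zX_central.
rewrite -invgR commg_centralMl => [|g]; last exact: Tor_zX_central.
rewrite invgR /free_comm; case: insubP => [ij _ ijE|].
  by rewrite /free_to_Tor pres_liftE //= mulg1 /letter_lift ijE.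
rewrite negb_and !negbK -word_val_nil /free_to_Tor pres_liftE //=.
by case/orP => /eqP [->]; rewrite expg0 ?comm1g ?commg1.
Qed.

Definition free_Z_to_Tor (u : F * Algebra.to_multiplicative int) : G :=
  free_to_Tor u.1 * expgz z u.2.

Lemma free_Z_to_TorM : {morph free_Z_to_Tor : u v / u * v}.
Proof.
move=> [p k] [q l]; rewrite /free_Z_to_Tor /= free_to_TorM.
rewrite [expgz _ _](expgzD G z k l) -!mulgA; congr (_ * _); rewrite !mulgA.
by congr (_ * _); apply: commute_expgz; apply/commute_sym/Tor_z_central.
Qed.

(** Powers of z fix (0, 0, 1), so the action forces p = 1; what remains is a trivial power of z, an
    element of infinite order. *)
Lemma free_Z_to_Tor_ker u : free_Z_to_Tor u = 1 -> u = 1.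
Proof.
case: u => p k; rewrite /free_Z_to_Tor /= => pk1.
have actz : gact (expgz z k) (ord0, ord0, 1) = (ord0, ord0, 1).
  have actX i : gact (z ^+ i) (ord0, ord0, 1) = (ord0, ord0, 1).
    by rewrite gactX; apply: iter_fix; apply: gact_z.
  by case: k {pk1} => i; rewrite /expgz // -{1}(actX i.+1) gactK.
have p1 : p = 1.
  by have := gact_free p; rewrite -{1}actz -gactM pk1 gact1 => -[].
move: pk1; rewrite p1 /free_to_Tor -{1}word_val_nil pres_liftE // mul1g.
by move/(expgz_eq1 _ _ _ (Tor_z_infinite _ _ (ltn0Sn m') (ltn0Sn n'))) => ->.
Qed.

Definition free_Z_subgroup : {pred G} :=
  [pred g | `[< exists u, free_Z_to_Tor u = g >]].

Lemma free_Z_subgroupM :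
  {in free_Z_subgroup &, forall g h, g * h \in free_Z_subgroup}.
Proof.
move=> _ _ /asboolP [u <-] /asboolP [v <-]; apply/asboolP; exists (u * v).
exact: free_Z_to_TorM.
Qed.

Lemma free_Z_subgroup_closed : group_closed free_Z_subgroup.
Proof.
have F1 : free_Z_to_Tor 1 = 1.
  by apply: (mulgI (free_Z_to_Tor 1)); rewrite -free_Z_to_TorM !mulg1.
split=> [|g h gH /asboolP [v <-]]; first by apply/asboolP; exists 1.
apply: free_Z_subgroupM => //; apply/asboolP; exists v^-1.
by apply: (mulIg (free_Z_to_Tor v)); rewrite -free_Z_to_TorM !mulVg.
Qed.

Lemma comm_in_free_Z i j : [~ a ^+ i, b ^+ j] \in free_Z_subgroup.
Proof.
apply/asboolP; exists (free_comm (inZp i) (inZp j), 0%R).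
by rewrite /free_Z_to_Tor free_comm_Tor mulg1.
Qed.

Lemma z_in_free_Z k : z ^+ k \in free_Z_subgroup.
Proof.
apply/asboolP; exists (1, Posz k).
by rewrite /free_Z_to_Tor /free_to_Tor -word_val_nil pres_liftE // mul1g.
Qed.

(** The union of the cosets is stable under left multiplication by generators: a raises i, and b
    raises j up to two commutators in the subgroup. *)
Lemma free_Z_cosets g : exists i j : nat, exists2 h, h \in free_Z_subgroup &
  g = a ^+ i * b ^+ j * h.
Proof.
have [H1 HD] := free_Z_subgroup_closed.
have HV h : h \in free_Z_subgroup -> h^-1 \in free_Z_subgroup.
  by move=> hH; rewrite -[h^-1]mul1g HD.
pose covered g := exists i j : nat, exists2 h, h \in free_Z_subgroup &
  g = a ^+ i * b ^+ j * h.
have stepX x k g' : covered g' -> covered (Tor_gen m n x ^+ k * g').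
  elim: k => [|k IHk] g'P; first by rewrite mul1g.
  have [i [j [h hH gE]]] := IHk g'P; rewrite expgS -mulgA gE.
  case: x {IHk gE}; last by exists i.+1, j, h; rewrite // expgS !mulgA.
  exists i, j.+1, ([~ a ^+ i, b ^+ j.+1]^-1 * [~ a ^+ i, b ^+ j] * h).
    by do 2?apply: free_Z_subgroupM => //; rewrite ?HV ?comm_in_free_Z.
  rewrite !mulgA [a ^+ i * b ^+ j.+1]commgC mulgK expgS -!mulgA; congr (_ * _).
  by rewrite !mulgA mulgK mulgV mul1g.
elim/Tor_ind: g => [|x g IHg]; first by exists 0%N, 0%N, 1; rewrite // !mulg1.
split; first by rewrite -[Tor_gen _ _ x]expg1; apply: stepX.
(* An inverse generator becomes a natural power times z^-1, which is central and lies in the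
   subgroup. *)
have -> : (Tor_gen m n x)^-1 * g =
          Tor_gen m n x ^+ (Tor_ord m n x).-1 * (z^-1 * g).
  have := Tor_gen_ord m n x.
  case: (Tor_ord m n x) (Tor_ord_gt0 m n isT isT x) => // k _ <- /=.
  by rewrite [in RHS]expgS invgM -mulgA mulVKg.
apply: stepX; have [i [j [h hH ->]]] := IHg; exists i, j, (z^-1 * h).
  by apply: free_Z_subgroupM => //; rewrite HV // (z_in_free_Z 1).
have zC : commute (a ^+ i * b ^+ j) z^-1.
  exact/commuteV/commute_sym/Tor_z_central.
by rewrite [RHS]mulgA zC !mulgA.
Qed.

(** Reducing i modulo m and j modulo n costs only powers of z, which lie in the subgroup. *)
Lemma free_Z_finite_index : finite_index free_Z_subgroup.
Proof.
have [H1 HD] := free_Z_subgroup_closed.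
exists [seq a ^+ i * b ^+ j | i <- iota 0 m, j <- iota 0 n] => g.
have [i [j [h hH ->]]] := free_Z_cosets g.
exists (a ^+ (i %% m) * b ^+ (j %% n)).
  by apply/allpairsP; exists (i %% m, j %% n)%N; rewrite !mem_iota !ltn_mod.
have -> : a ^+ i * b ^+ j =
    a ^+ (i %% m) * b ^+ (j %% n) * (z ^+ (j %/ n) * z ^+ (i %/ m)).
  rewrite (Tor_gen_mod _ _ false i) (Tor_gen_mod _ _ true j) -!mulgA.
  by congr (_ * _); rewrite [LHS]Tor_zX_central -mulgA.
rewrite -[_ * _ * h]mulgA mulKg.
by do ?apply: free_Z_subgroupM => //; apply: z_in_free_Z.
Qed.

Lemma Tor_virtually_free_times_Z : virtually_free_times_Z G.
Proof.
exists free_Z_subgroup, comm_index; split.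
- exact: free_Z_subgroup_closed.
- exact: free_Z_finite_index.
pose K := (F * Algebra.to_multiplicative int)%type.
pose f : {multiplicative K -> G} := HB.pack (free_Z_to_Tor : K -> G)
  (isMultiplicative.Build K G free_Z_to_Tor free_Z_to_TorM).
exists f; split=> [u v /= fuv|g]; last first.
  by split=> [/asboolP [u <-]|[u <-]]; [exists u | apply/asboolP; exists u].
apply/divg1_eq/free_Z_to_Tor_ker/(mulIg (free_Z_to_Tor v)).
by rewrite -free_Z_to_TorM mulgVK mul1g; exact: fuv.
Qed.

End FreeTimesCyclicSubgroup.

(** * Normal forms modulo the center *)

Section NormalForms.
Variables m n : nat.
Hypotheses (m_gt0 : (0 < m)%N) (n_gt0 : (0 < n)%N).

Local Notation G := (Tor m n).
Local Notation M := (Tor_ord m n).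
Local Notation Mgt0 := (Tor_ord_gt0 m n m_gt0 n_gt0).
Local Notation alternating := (sorted [rel x y : bool | x != y]).

(* The list [:: (x1, r1); ...; (xk, rk)] stands for the element
   x1^r1 ... xk^rk of the quotient Z/m * Z/n of [G] by its central subgroup
   generated by a^m; [nf_act x r] is left multiplication by x^r. *)
Definition nf_valid (s : seq (bool * nat)) :=
  alternating (unzip1 s) && all (fun t => 0 < t.2 < M t.1)%N s.

Definition nf_push x r (s : seq (bool * nat)) :=
  if (r %% M x == 0)%N then s else (x, (r %% M x)%N) :: s.

Definition nf_act x r (s : seq (bool * nat)) :=
  if s is (y, q) :: s' then
    if x == y then nf_push x (r + q) s' else nf_push x r s
  else nf_push x r s.

Lemma nf_act_head x r s :
  path [rel x y : bool | x != y] x (unzip1 s) -> nf_act x r s = nf_push x r s.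
Proof. by case: s => [|[y q] s] //= /andP [/negPf ->]. Qed.

Lemma eq_nf_push x r r' s : r = r' %[mod M x] -> nf_push x r s = nf_push x r' s.
Proof. by rewrite /nf_push => ->. Qed.

(** Allowing q = 0 treats uniformly the normal forms that start with x and those that do not; x^r
    then acts by adding r to q. *)
Lemma nf_split x s : nf_valid s -> exists q s',
  [/\ s = nf_push x q s', path [rel x y : bool | x != y] x (unzip1 s') &
      nf_valid s'].
Proof.
case: s => [|[y q] s]; first by exists 0%N, [::]; rewrite /nf_push mod0n.
case: (eqVneq x y) => [-> /andP [/= ys /andP [/andP [q_gt0 ltqM] sP]]|xy sP].
  exists q, s; rewrite /nf_push modn_small // eqn0Ngt q_gt0.
  by split; rewrite // /nf_valid sP (path_sorted ys).
exists 0%N, ((y, q) :: s); rewrite /nf_push mod0n; split=> //=.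
by rewrite xy; case/andP: sP.
Qed.

Lemma nf_act_push x r q s : path [rel x y : bool | x != y] x (unzip1 s) ->
  nf_act x r (nf_push x q s) = nf_push x (r + q) s.
Proof.
move=> xs; rewrite [nf_push x q s]/nf_push; case: ifP => [/eqP q0|q0].
  by rewrite nf_act_head //; apply: eq_nf_push; rewrite -modnDmr q0 addn0.
by rewrite /nf_act eqxx; apply: eq_nf_push; rewrite modnDmr.
Qed.

Lemma nf_push_valid x r s : path [rel x y : bool | x != y] x (unzip1 s) ->
  nf_valid s -> nf_valid (nf_push x r s).
Proof.
move=> xs /andP [sA sP]; rewrite /nf_push; case: ifP => [_|r0].
  by rewrite /nf_valid sA.
by rewrite /nf_valid /= xs sP lt0n r0 ltn_mod Mgt0.
Qed.

Lemma nf_act_valid x r s : nf_valid s -> nf_valid (nf_act x r s).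
Proof.
by case/(nf_split x) => q [s' [-> xs sP]]; rewrite nf_act_push // nf_push_valid.
Qed.

Lemma nf_actD x r r' s : nf_valid s ->
  nf_act x r (nf_act x r' s) = nf_act x (r + r') s.
Proof.
by case/(nf_split x) => q [s' [-> xs sP]]; rewrite !nf_act_push // addnA.
Qed.

Lemma nf_act_ord x k s : nf_valid s -> nf_act x (k * M x) s = s.
Proof.
case/(nf_split x) => q [s' [-> xs sP]]; rewrite nf_act_push //.
by apply: eq_nf_push; rewrite modnMDl.
Qed.

(** Modulo z, x^-1 is x^(M x - 1), so exponents stay natural numbers. *)
Definition letter_exp (l : bool * bool) : nat := if l.2 then (M l.1).-1 else 1%N.

Definition nf_letter (l : bool * bool) := nf_act l.1 (letter_exp l).

Definition nf_run (w : word bool) := foldr nf_letter [::] w.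

Lemma foldr_nf_letter_nseq k l s : nf_valid s ->
  foldr nf_letter s (nseq k l) = nf_act l.1 (k * letter_exp l) s.
Proof.
move=> sP; elim: k => [|k /= ->]; first exact/esym/(nf_act_ord l.1 0).
by rewrite [LHS]nf_actD // mulSn.
Qed.

Lemma nf_run_eq u v : Tor_val m n u = Tor_val m n v -> nf_run u = nf_run v.
Proof.
move/word_valP => uv.
(* Inverse letters act by inverse maps on valid normal forms, hence the restriction to this
   subtype. *)
pose act l (s : {s | nf_valid s}) : {s | nf_valid s} :=
  exist _ (nf_letter l (val s)) (nf_act_valid l.1 (letter_exp l) _ (valP s)).
have valE w s : val (foldr act s w) = foldr nf_letter (val s) w.
  by elim: w => //= l w ->.
have relE x t : nf_valid t -> foldr nf_letter t (syllable x false (M x)) = t.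
  by move=> tP; rewrite foldr_nf_letter_nseq // mulnC nf_act_ord.
have := valE u (exist _ [::] isT); rewrite /nf_run /= => <-.
have := valE v (exist _ [::] isT); rewrite /nf_run /= => <-; congr val.
apply: pres_eq_foldr uv _ => [[x s] y|_ _ y []]; apply: val_inj.
  rewrite /= /nf_letter nf_actD ?(valP y) //=.
  rewrite -[RHS](nf_act_ord x 1) ?(valP y) // mul1n; congr nf_act.
  by rewrite /letter_exp; case: s; rewrite /= ?addn1 ?add1n prednK ?Mgt0.
by rewrite !valE [LHS](relE tor_a) ?[RHS](relE tor_b) ?(valP y).
Qed.

(* The entry [((x, s), k)] stands for [syllable x s k]. *)
Definition syl_word (p : seq (bool * bool * nat)) : word bool :=
  flatten [seq nseq t.2 t.1 | t <- p].

Definition syl_gens (p : seq (bool * bool * nat)) : seq bool :=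
  [seq t.1.1 | t <- p].

Definition syl_small p :=
  alternating (syl_gens p) && all (fun t => 0 < t.2 < M t.1.1)%N p.

Definition syl_nf (p : seq (bool * bool * nat)) : seq (bool * nat) :=
  [seq (t.1.1, (t.2 * letter_exp t.1) %% M t.1.1)%N | t <- p].

Lemma unzip1_syl_nf p : unzip1 (syl_nf p) = syl_gens p.
Proof. by rewrite /unzip1 -map_comp. Qed.

(** Both 1 and M - 1 are coprime to M, so neither turns a nonmultiple of M into a multiple. *)
Lemma letter_exp_neq0 l k : (0 < k < M l.1)%N -> (k * letter_exp l) %% M l.1 != 0%N.
Proof.
case/andP => k_gt0 ltkM; rewrite -/(dvdn _ _) Gauss_dvdl.
  by rewrite gtnNdvd.
rewrite /letter_exp; case: l.2; last exact: coprimen1.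
by case: (M l.1) (Mgt0 l.1) => // k' _; rewrite /= coprimeSn.
Qed.

Lemma syl_nf_valid p : syl_small p -> nf_valid (syl_nf p).
Proof.
case/andP => pA pP; rewrite /nf_valid unzip1_syl_nf pA all_map.
apply: sub_all pP => t tP /=; by rewrite lt0n letter_exp_neq0 //= ltn_mod Mgt0.
Qed.

(** Neighbouring syllables have different generators and none vanishes modulo z, so nothing merges
    or cancels. *)
Lemma nf_run_syl_word p : syl_small p -> nf_run (syl_word p) = syl_nf p.
Proof.
elim: p => // t p IHp /andP [/= tp /andP [tP pP]].
have pS : syl_small p by rewrite /syl_small pP (path_sorted tp).
rewrite /nf_run [syl_word _]/= foldr_cat -/(nf_run _) IHp //.
rewrite foldr_nf_letter_nseq ?syl_nf_valid // nf_act_head ?unzip1_syl_nf //.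
by rewrite /nf_push (negPf (letter_exp_neq0 _ _ tP)).
Qed.

Lemma nf_run_nseq_syl_word l k p : syl_small p ->
  path [rel x y : bool | x != y] l.1 (syl_gens p) ->
  nf_run (nseq k l ++ syl_word p) = nf_push l.1 (k * letter_exp l) (syl_nf p).
Proof.
move=> pS lp; rewrite /nf_run foldr_cat -/(nf_run _) nf_run_syl_word //.
by rewrite foldr_nf_letter_nseq ?syl_nf_valid // nf_act_head ?unzip1_syl_nf.
Qed.

(** A letter in front of a syllable of the same generator either extends it or is inverse to its
    letters; reducedness excludes the latter. *)
Lemma reduced_syl_word w : reduced w -> exists p,
  [/\ w = syl_word p, alternating (syl_gens p) & all (fun t => 0 < t.2)%N p].
Proof.
elim: w => [|l w IHw] lwR; first by exists [::].
have [|p [wE pA pP]] := IHw.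
  by move=> l'; apply: contra (lwR l') => H; exact: (infix_catl [:: l] H).
case: p wE pA pP => [|[l' [|k]] p] wE /= pA //=.
  by exists [:: (l, 1%N)]; rewrite wE.
move=> pP; case: (eqVneq l.1 l'.1) => [ll'|ll']; last first.
  by exists [:: (l, 1%N), (l', k.+1) & p]; rewrite wE /= ll' pA.
case: (eqVneq l l') => [->|ne_ll'].
  by exists ((l', k.+2) :: p); rewrite wE.
have l'E : l' = letter_inv l.
  by move: l l' ll' ne_ll' {lwR wE pA} => [x s] [y t] /= ->; case: s t => [] [] /eqP.
case/negP: (lwR l); apply/infixP; exists [::], (nseq k l' ++ syl_word p).
by rewrite wE l'E.
Qed.

(** If every syllable were small, the normal form would keep them all and be nonempty; so some
    syllable has at least [M x] letters. *)
Lemma reduced_trivial_infix w : w <> [::] -> reduced w -> Tor_val m n w = 1 ->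
  exists s, infix (syllable tor_a s m) w \/ infix (syllable tor_b s n) w.
Proof.
move=> w0 /reduced_syl_word [p [wE pA pP]] w1.
have: ~~ all (fun t => t.2 < M t.1.1)%N p.
  apply: contra_notN w0 => pM; rewrite wE.
  have pS : syl_small p by rewrite /syl_small pA; apply/allP => t tp;
    rewrite (allP pP) ?(allP pM).
  move: w1; rewrite -(word_val_nil (tor_relator m n)) => /nf_run_eq.
  by rewrite wE nf_run_syl_word //; case: (p).
case/allPn => [[[x s] k]] /= /splitPr pE; rewrite -leqNgt => leMk.
have: infix (syllable x s (M x)) w.
  rewrite wE; case: p / pE {wE pA pP} => p1 p2.
  apply/infixP; exists (syl_word p1), (nseq (k - M x) (x, s) ++ syl_word p2).
  rewrite /syl_word map_cat flatten_cat /=; congr (_ ++ _).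
  by rewrite catA /syllable -nseqD subnKC.
by exists s; case: (x) H => /=; [right | left].
Qed.

(** * Reducing words by replacements and free reductions *)

Local Notation reduces := (tor_reduces m n).

Lemma tor_reduces_trans u v w : reduces u v -> reduces v w -> reduces u w.
Proof. exact: rt_trans. Qed.

Lemma tor_reduces_ctx s t u v : reduces u v ->
  reduces (s ++ u ++ t) (s ++ v ++ t).
Proof.
elim=> {u v} [u v uv|u|u v w _ IH1 _ IH2]; first 1 last.
- exact: rt_refl.
- exact: rt_trans IH1 IH2.
apply: rt_step; case: uv => [_ _ [u' v' l]|u' v' e|u' v' e].
- have := FreeReduction (s ++ u') (v' ++ t) l.
  by rewrite -!catA; exact: TorStepFree.
- by have := TorStepAB m n (s ++ u') (v' ++ t) e; rewrite -!catA.
- by have := TorStepBA m n (s ++ u') (v' ++ t) e; rewrite -!catA.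
Qed.

Lemma tor_reduces_catr t u v : reduces u v -> reduces (u ++ t) (v ++ t).
Proof. exact: (tor_reduces_ctx [::]). Qed.

Lemma tor_reduces_Tor_val u v : reduces u v -> Tor_val m n u = Tor_val m n v.
Proof.
elim=> {u v} [u v uv|u|u v w _ IH1 _ IH2]; last 2 first.
- by [].
- by rewrite IH1.
have synE x s : Tor_val m n (syllable x s (M x)) =
                if s then (Tor_z m n)^-1 else Tor_z m n.
  by rewrite Tor_val_syllable -(Tor_gen_ord m n x).
case: uv => [u' v' uv|u' v' e|u' v' e].
- exact/word_valP/PresFree.
- by rewrite /Tor_val !word_val_cat; congr (_ * (_ * _));
    rewrite [LHS](synE tor_a) [RHS](synE tor_b).
- by rewrite /Tor_val !word_val_cat; congr (_ * (_ * _));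
    rewrite [RHS](synE tor_a) [LHS](synE tor_b).
Qed.

Lemma tor_reduces_swap x s q :
  reduces (nseq (q * M x) (x, s)) (nseq (q * M (~~ x)) (~~ x, s)).
Proof.
elim: q => [|q IHq]; first exact: rt_refl.
rewrite !mulSn !nseqD; apply: (tor_reduces_trans
  _ (nseq (M (~~ x)) (~~ x, s) ++ nseq (q * M x) (x, s))).
  apply/tor_reduces_catr/rt_step.
  rewrite -[nseq (M x) _]cats0 -[nseq (M (~~ x)) _]cats0.
  by case: x {IHq}; [exact: (TorStepBA m n [::] [::]) | exact: (TorStepAB m n [::] [::])].
by have := tor_reduces_ctx (nseq (M (~~ x)) (~~ x, s)) [::] _ _ IHq; rewrite !cats0.
Qed.

(** Opposite signs cancel freely at the junction until one of the powers runs out. *)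
Lemma tor_reduces_merge x s t j k : exists l u,
  reduces (nseq j (x, s) ++ nseq k (x, t)) (nseq l (x, u)).
Proof.
case: (eqVneq s t) => [->|st].
  by exists (j + k)%N, t; rewrite nseqD; apply: rt_refl.
elim: j k => [|j IHj] [|k].
- by exists 0%N, s; apply: rt_refl.
- by exists k.+1, t; apply: rt_refl.
- by exists j.+1, s; rewrite cats0; apply: rt_refl.
have [l [u red]] := IHj k; exists l, u; apply: tor_reduces_trans red.
apply/rt_step/TorStepFree.
have -> : nseq j.+1 (x, s) ++ nseq k.+1 (x, t) =
    nseq j (x, s) ++ [:: (x, s); letter_inv (x, s)] ++ nseq k (x, t).
  rewrite -addn1 nseqD -catA /letter_inv /=.
  by case: s t st {IHj} => [] [].
exact: FreeReduction.
Qed.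

(* A word is rewritten from right to left. The invariant keeps all syllables
   small but the leftmost one, a power of [x], whose multiples of a^m = b^n
   are pushed into the next syllable when the leftmost syllable has to become
   a power of the other generator. *)
Definition reduces_to_form x w := exists s k p,
  [/\ syl_small p, path [rel x y : bool | x != y] x (syl_gens p) &
      reduces w (nseq k (x, s) ++ syl_word p)].

Lemma reduces_to_form_switch x w :
  reduces_to_form x w -> reduces_to_form (~~ x) w.
Proof.
case=> s [k [p [pS xp red]]].
(* Division by [M x]: the full multiples become a power of the other generator, and the remainder is
   less than [M x]. *)
have {}red : reduces w (nseq (k %/ M x * M (~~ x)) (~~ x, s) ++
    nseq (k %% M x) (x, s) ++ syl_word p).
  apply: tor_reduces_trans red _; rewrite {1}(divn_eq k (M x)) nseqD -catA.
  exact/tor_reduces_catr/tor_reduces_swap.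
case: (posnP (k %% M x)) => [r0|r_gt0]; last first.
  exists s, (k %/ M x * M (~~ x))%N, ((x, s, (k %% M x)%N) :: p); split=> //=.
    by rewrite /syl_small /= r_gt0 ltn_mod Mgt0 xp; case/andP: pS.
  by rewrite xp andbT; case: (x).
(* With remainder 0, the pushed power meets the first syllable of [p], if any, which is a power of
   the same generator; the two are merged. *)
rewrite r0 /= in red; case: p pS xp red => [|[[y t] j] p] pS xp red.
  by exists s, (k %/ M x * M (~~ x))%N, [::]; split.
have yE : y = ~~ x by case/andP: xp; case: (x) (y) => [] [].
case/andP: pS => [/= yp /andP [_ pP]]; rewrite yE in yp red.
have [l [u red']] := tor_reduces_merge (~~ x) s t (k %/ M x * M (~~ x)) j.
exists u, l, p; split=> //; first by rewrite /syl_small (path_sorted yp).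
apply: tor_reduces_trans red _; rewrite /= catA.
exact: tor_reduces_catr red'.
Qed.

Lemma word_reduces_to_form x w : reduces_to_form x w.
Proof.
elim: w x => [|[y t] w IHw] x.
  by exists false, 0%N, [::]; split=> //; apply: rt_refl.
suff yP : reduces_to_form y ((y, t) :: w).
  case: (eqVneq x y) => [-> //|xy].
  have -> : x = ~~ y by case: (x) (y) xy => [] [].
  exact: reduces_to_form_switch.
have [s [k [p [pS yp red]]]] := IHw y.
have [l [u red']] := tor_reduces_merge y t s 1 k.
exists u, l, p; split=> //.
apply: (tor_reduces_trans _ _ _ _ (tor_reduces_catr _ _ _ red')).
by have := tor_reduces_ctx [:: (y, t)] [::] _ _ red; rewrite !cats0.
Qed.

(** The normal form of the final word is empty, so only a power of a is left; it is trivial, and a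
    has infinite order. *)
Lemma trivial_word_reduces w : Tor_val m n w = 1 -> tor_reduces m n w [::].
Proof.
have [s [k [p [pS ap red]]]] := word_reduces_to_form tor_a w.
rewrite (tor_reduces_Tor_val _ _ red) => w1.
have := w1; rewrite -(word_val_nil (tor_relator m n)) => /nf_run_eq.
rewrite nf_run_nseq_syl_word // /nf_push; case: ifP => // _.
case: p {pS ap} w1 red => //; rewrite cats0 => w1 red _.
suff k0 : k = 0%N by rewrite k0 in red.
apply: (Tor_gen_infinite m n m_gt0 n_gt0 tor_a).
move: w1; rewrite [Tor_val _ _ _]Tor_val_syllable; case: s {red} => // /eqP.
by rewrite invg_eq1 => /eqP.
Qed.

(** * The center *)

Lemma Tor_syl_word g : exists k p, syl_small p /\
  g = expgz (Tor_z m n) k * Tor_val m n (syl_word p).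
Proof.
rewrite -(word_val_repr g) -/(Tor_val m n _).
have [s [k [p [pS ap /tor_reduces_Tor_val ->]]]] := word_reduces_to_form tor_a (repr g).
have -> : Tor_val m n (nseq k (tor_a, s) ++ syl_word p) =
    expgz (Tor_z m n) (if s then - (k %/ m)%:Z else (k %/ m)%:Z)%R *
    Tor_val m n (nseq (k %% m) (tor_a, s) ++ syl_word p).
  rewrite /Tor_val !word_val_cat mulgA; congr (_ * _).
  rewrite [LHS]Tor_val_syllable [word_val _ _]Tor_val_syllable.
  rewrite (Tor_gen_mod _ _ tor_a k) /=; case: s.
    by rewrite -[(- _)%R]GRing.sub0r (expgzB _ _ 0) mul1g invgM.
  by rewrite Tor_zX_central.
eexists; case: (posnP (k %% m)) => [r0|r_gt0].
  by exists p; rewrite r0.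
exists ((tor_a, s, (k %% m)%N) :: p); split=> //.
by rewrite /syl_small /= r_gt0 ltn_mod m_gt0 ap; case/andP: pS.
Qed.

(** On the right, the generator other than the last one adds a syllable. On the left, it either
    precedes a different generator, so that the first syllables differ, or meets its own syllable,
    so that the number of syllables does not grow. *)
Lemma central_syl_word p : (1 < m)%N -> (1 < n)%N -> syl_small p ->
  (forall x, commute (Tor_val m n (syl_word p)) (Tor_gen m n x)) -> p = [::].
Proof.
move=> m_gt1 n_gt1; case/lastP: p => // p [[y s] k] pS /(_ (~~ y)) pC.
have M_gt1 x : (1 < M x)%N by case: x.
set q := rcons p _ in pS pC *.
have qyS : syl_small (rcons q (~~ y, false, 1%N)).
  case/andP: pS => qA qP; rewrite /syl_small all_rcons /= M_gt1 qP andbT.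
  rewrite /syl_gens map_rcons; move: qA; rewrite /syl_gens /q map_rcons.
  case: (map _ p) => [_|x t] /=; first by case: (y).
  by rewrite !rcons_path last_rcons => ->; case: (y).
have : nf_run (syl_word q ++ [:: (~~ y, false)]) =
       nf_run ((~~ y, false) :: syl_word q).
  apply: nf_run_eq; rewrite -[_ :: syl_word q]cat1s /Tor_val !word_val_cat.
  exact: pC.
have -> : syl_word q ++ [:: (~~ y, false)] = syl_word (rcons q (~~ y, false, 1%N)).
  by rewrite /syl_word map_rcons flatten_rcons.
rewrite nf_run_syl_word // [RHS]/= -/(nf_run _) nf_run_syl_word //.
rewrite /syl_nf map_rcons -/(syl_nf q) /nf_letter /=.
have : (0 < size (syl_nf q))%N by rewrite size_map size_rcons.
case: (syl_nf q) => // [[x r] t] _ /=; case: eqVneq => [_|yx]; last first.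
  by rewrite /nf_push /letter_exp modn_small //= => -[xy]; rewrite xy eqxx in yx.
move/(congr1 size); rewrite /nf_push; case: ifP => _ /=; rewrite size_rcons.
  by move/eqP; rewrite gtn_eqF // ltnW.
by move/eqP; rewrite eqSS gtn_eqF.
Qed.

Lemma center_Tor_z : (1 < m)%N -> (1 < n)%N ->
  center G =i cyclic_subgroup (Tor_z m n).
Proof.
move=> m_gt1 n_gt1 g; rewrite !inE; apply/asboolP/asboolP => [gC|[k ->] h].
  have [k [p [pS gE]]] := Tor_syl_word g; exists k; rewrite gE.
  rewrite (central_syl_word p) // ?[Tor_val _ _ _]word_val_nil ?mulg1 // => x.
  have -> : Tor_val m n (syl_word p) = (expgz (Tor_z m n) k)^-1 * g.
    by rewrite gE mulKg.
  apply/commute_sym/commuteM; last exact/commute_sym/gC.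
  exact/commuteV/commute_expgz/commute_sym/Tor_z_central.
exact/commute_sym/commute_expgz/commute_sym/Tor_z_central.
Qed.

(** The relation makes the other generator a power of x, so the group is cyclic, generated by x, and
    equals its center. *)
Lemma center_Tor_gen x : M (~~ x) = 1%N ->
  center G =i cyclic_subgroup (Tor_gen m n x).
Proof.
move=> Mx1.
have genE y : exists k, Tor_gen m n y = Tor_gen m n x ^+ k.
  case: (eqVneq y x) => [->|yx]; first by exists 1%N.
  have -> : y = ~~ x by case: (y) (x) yx => [] [].
  by exists (M x); rewrite Tor_gen_ord -(Tor_gen_ord m n (~~ x)) Mx1.
have allP g : exists k, g = expgz (Tor_gen m n x) k.
  elim/Tor_ind: g => [|y g [k ->]]; first by exists 0%R.
  have [j ->] := genE y; split; first by exists (Posz j + k)%R; rewrite expgzD.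
  exists ((0 - Posz j) + k)%R.
  by rewrite expgzD (expgzB _ _ 0) mul1g.
move=> g; rewrite !inE; apply/asboolP/asboolP => [_|_ h]; first exact: allP.
have [[i ->] [j ->]] := (allP g, allP h).
exact/commute_expgz/commute_sym/commute_expgz/commute_refl.
Qed.

Lemma center_Tor_infinite_cyclic : infinite_cyclic (center G).
Proof.
have [m1|m1] := eqVneq m 1%N.
  exact: cyclic_infinite (Tor_gen_infinite _ _ _ _ true) (center_Tor_gen true m1).
have [n1|n1] := eqVneq n 1%N.
  exact: cyclic_infinite (Tor_gen_infinite _ _ _ _ false) (center_Tor_gen false n1).
apply: cyclic_infinite (Tor_z_infinite _ _ _ _) _ => //.
by apply: center_Tor_z; rewrite ltn_neqAle eq_sym ?m1 ?n1.
Qed.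

Lemma center_Tor_cyclic : (m = 1%N <-> n = 1%N) ->
  center G =i cyclic_subgroup (Tor_z m n).
Proof.
move=> mn; have [m1|m1] := eqVneq m 1%N.
  (* Here m = n = 1, so z = b^n is b itself. *)
  have -> : Tor_z m n = Tor_gen m n true.
    by rewrite -(Tor_gen_ord m n true) [M true](mn.1 m1).
  exact: center_Tor_gen.
have n1 : n != 1%N by apply: contra_neq m1 => /mn.
by apply: center_Tor_z; rewrite ltn_neqAle eq_sym ?m1 ?n1.
Qed.

End NormalForms.

(* The hypothesis [m = 1 <-> n = 1] below excludes only the case where exactly
   one of m, n is 1: for m = 1 < n, Tor m n is the infinite cyclic group
   generated by b, which is its own center and is not generated by b^n. *)
Theorem theorem4p2 (m n : nat) (m_gt0 : (0 < m)%N) (n_gt0 : (0 < n)%N) :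
  [/\ [/\ Tor_a m n ^+ m = Tor_b m n ^+ n,
          infinite_cyclic (center (Tor m n)) &
          (m = 1%N <-> n = 1%N) ->
            center (Tor m n) =i cyclic_subgroup (Tor_a m n ^+ m)],
      virtually_free_times_Z (Tor m n),
      (forall w : word bool, w <> [::] -> reduced w -> Tor_val m n w = 1 ->
         exists s : bool, infix (syllable tor_a s m) w \/
                          infix (syllable tor_b s n) w) &
      (forall w : word bool, Tor_val m n w = 1 -> tor_reduces m n w [::])].
Proof.
split; first split.
- exact/esym/(Tor_gen_ord m n true).
- exact: center_Tor_infinite_cyclic.
- exact: center_Tor_cyclic.
- case: m m_gt0 => // m' _; case: n n_gt0 => // n' _.
  exact: Tor_virtually_free_times_Z.
- exact: reduced_trivial_infix.
- exact: trivial_word_reduces.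
Qed.
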